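(* $\mathrm{Sort}(12)=\mathcal{C}(213)$.
   Context: A Cayley permutation is a finite word $\pi=\pi_1\cdots\pi_n$ over the positive integers such that every integer from $1$ to $\max(\pi)$ occurs at least once; $\mathcal{C}$ denotes the set of all Cayley permutations. A word $x=x_1\cdots x_n$ contains a pattern $p=p_1\cdots p_k$ if there are indices $i_1<\cdots<i_k$ such that for all $u,v$: $x_{i_u}<x_{i_v}$ iff $p_u<p_v$, and $x_{i_u}=x_{i_v}$ iff $p_u=p_v$; otherwise $x$ avoids $p$. $\mathcal{C}(213)$ is the set of Cayley permutations avoiding $213$. For a Cayley permutation $\tau$ of length at least two, a $\tau$-stack processes an input word from left to right with the following right-greedy algorithm: while the input is nonempty, if pushing the next input element onto the stack yields stack contents which, read from top to bottom, avoid $\tau$, the element is pushed; otherwise the top element of the stack is popped and appended to the output. When the input is exhausted, the remaining elements are popped one by one. Denote by $s_\tau(\pi)$ the output of the $\tau$-stack on input $\pi$. The $\sigma$-machine consists of a $\sigma$-stack followed in series by a $21$-stack: $s_\sigma(\pi)$ is used as input of a $21$-stack operated by the same algorithm with $\tau=21$. A Cayley permutation $\pi$ is $\sigma$-sortable if the final output of the $\sigma$-machine on input $\pi$ is weakly increasing; $\mathrm{Sort}(\sigma)$ denotes the set of $\sigma$-sortable Cayley permutations. Here $\sigma=12$. *)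

(* Defs.v *)
From mathcomp Require Import all_boot.

Set Implicit Arguments.
Unset Strict Implicit.
Unset Printing Implicit Defensive.

(* The empty word is a Cayley permutation: its maximum is 0 by convention. *)
Definition Cayley : pred (seq nat) :=
  [pred pi : seq nat |
    (0 \notin pi) && all (fun k => k \in pi) (iota 1 (\max_(a <- pi) a))].

Definition is_occurrence (p x : seq nat)
    (i : {ffun 'I_(size p) -> 'I_(size x)}) : bool :=
  [forall u : 'I_(size p), forall v : 'I_(size p),
    (u < v) ==> (i u < i v)] &&
  [forall u : 'I_(size p), forall v : 'I_(size p),
    ((nth 0 x (i u) < nth 0 x (i v)) == (nth 0 p u < nth 0 p v)) &&
    ((nth 0 x (i u) == nth 0 x (i v)) == (nth 0 p u == nth 0 p v))].

Definition contains (x p : seq nat) : bool :=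
  [exists i : {ffun 'I_(size p) -> 'I_(size x)}, is_occurrence i].

Definition avoids (x p : seq nat) : bool := ~~ contains x p.

Definition CayleyAv (p : seq nat) : pred (seq nat) :=
  [pred pi : seq nat | (pi \in Cayley) && avoids pi p].

(* A stack is the list of its elements from top to bottom. [stack_push tau a
   st out] pops from st to the end of the output out until a can be pushed,
   and returns the new stack and output. No test is made on the empty stack:
   a one-letter word avoids every tau of length at least two, the only case
   in which the tau-stack is meant. *)
Fixpoint stack_push (tau : seq nat) (a : nat) (st out : seq nat) :
    seq nat * seq nat :=
  match st with
  | [::] => ([:: a], out)
  | b :: st' => if avoids (a :: st) tau then (a :: st, out)
                else stack_push tau a st' (rcons out b)
  end.

Fixpoint stack_run (tau input st out : seq nat) : seq nat :=
  match input with
  | [::] => out ++ st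
  | a :: input' =>
      let: (st', out') := stack_push tau a st out in
      stack_run tau input' st' out'
  end.

Definition stack_map (tau pi : seq nat) : seq nat :=
  stack_run tau pi [::] [::].

Definition machine (sigma pi : seq nat) : seq nat :=
  stack_map [:: 2; 1] (stack_map sigma pi).

Definition Sort (sigma : seq nat) : pred (seq nat) :=
  [pred pi : seq nat | (pi \in Cayley) && sorted leq (machine sigma pi)].

(* Main.v *)
(** In the 12-stack an entry leaves before a larger later entry is pushed
    exactly when an even smaller entry comes between them.  Hence if [pi] avoids
    213, the output of the 12-stack is weakly decreasing, and the 21-stack
    reverses it.  If [b a c] is an occurrence of 213 in [pi], then [b] leaves
    before [c] enters, at which time the stack holds some [a' < b]; so
    [b c a'] is an occurrence of 231 in the output of the 12-stack, and the
    21-stack pops [b] at the latest when [c] arrives, hence before [a']. *)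
Require Import Defs.
From mathcomp Require Import all_boot.
From mathcomp Require Import zify.

Set Implicit Arguments.
Unset Strict Implicit.
Unset Printing Implicit Defensive.

(** * Subsequences and pattern occurrences *)

Lemma subseq_cat_split (T : eqType) (s1 s2 x : seq T) :
  subseq (s1 ++ s2) x ->
  exists x1 x2, [/\ x = x1 ++ x2, subseq s1 x1 & subseq s2 x2].
Proof.
elim: x s1 => [|y x IHx] [|a s1].
- by rewrite /= => /eqP->; exists [::], [::].
- by [].
- by rewrite cat0s => sub; exists [::], (y :: x).
- rewrite cat_cons /=; case: eqP => [->|neq] sub.
    have [x1 [x2 [-> sub1 sub2]]] := IHx _ sub.
    by exists (y :: x1), x2; rewrite /= eqxx.
  have [x1 [x2 [-> sub1 sub2]]] := IHx (a :: s1) sub.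
  by exists (y :: x1), x2; split => //; rewrite (subseq_trans sub1) ?subseq_cons.
Qed.

(** Trades the index function of the definition for the subsequence it selects, which is easier to
    follow through concatenations and stack steps. *)
Lemma containsP (x p : seq nat) :
  reflect (exists s, [/\ subseq s x, size s = size p &
             forall u v, u < size p -> v < size p ->
               (nth 0 s u < nth 0 s v) = (nth 0 p u < nth 0 p v) /\
               (nth 0 s u == nth 0 s v) = (nth 0 p u == nth 0 p v)])
          (contains x p).
Proof.
apply: (iffP existsP) => [[i /andP[/forallP iS /forallP iP]]|[s [sub szs sP]]].
  pose idx := [seq val (i u) | u <- enum 'I_(size p)].
  have szi : size idx = size p by rewrite size_map size_enum_ord.
  have idxE (u : 'I_(size p)) : nth 0 idx u = i u.
    by rewrite (nth_map u) ?size_enum_ord // nth_ord_enum.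
  exists [seq nth 0 x k | k <- idx]; split; last 2 first.
  - by rewrite size_map.
  - move=> u v ltu ltv; rewrite !(nth_map 0) ?szi //.
    have /forallP/(_ (Ordinal ltv))/andP[/eqP lt_uv /eqP eq_uv] :=
      iP (Ordinal ltu).
    by rewrite (idxE (Ordinal ltu)) (idxE (Ordinal ltv)).
  - rewrite -[X in subseq _ X](mkseq_nth 0); apply: map_subseq.
    have ltn_idx : sorted ltn idx.
      apply/(sortedP 0) => k; rewrite szi => ltk.
      have ltk' := ltnW ltk.
      rewrite (idxE (Ordinal ltk)) (idxE (Ordinal ltk')).
      have /forallP/(_ (Ordinal ltk))/implyP := iS (Ordinal ltk').
      exact.
    (* A strictly increasing list is determined by its set of elements, so [idx] is a filter of
       [iota 0 (size x)]. *)
    have -> : idx = [seq k <- iota 0 (size x) | k \in idx].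
      apply: (irr_sorted_eq ltn_trans ltnn) => //.
        by apply: sorted_filter; [exact: ltn_trans | exact: iota_ltn_sorted].
      move=> k; rewrite mem_filter mem_iota add0n.
      by case: mapP => // -[u _ ->] /=; rewrite ltn_ord.
    exact: filter_subseq.
have [m szm s_mask] := subseqP sub.
(* The mask that selects [s] from [x] also selects the positions of [s]. *)
pose idx := mask m (iota 0 (size x)).
have sE : s = [seq nth 0 x k | k <- idx].
  by rewrite s_mask -{1}[x](mkseq_nth 0) /mkseq map_mask.
have szi : size idx = size p by rewrite -szs sE size_map.
have lt_idx (u : 'I_(size p)) : nth 0 idx u < size x.
  have /(mem_nth 0) : u < size idx by rewrite szi.
  by move=> /mem_mask; rewrite mem_iota.
have ltn_idx : sorted ltn idx.
  by apply: sorted_mask; [exact: ltn_trans | exact: iota_ltn_sorted].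
exists [ffun u => Ordinal (lt_idx u)]; apply/andP; split.
  apply/forallP => u; apply/forallP => v; apply/implyP => ltuv.
  rewrite !ffunE /=.
  by apply: (sorted_ltn_nth ltn_trans) => //; rewrite inE szi.
apply/forallP => u; apply/forallP => v; rewrite !ffunE /=.
have s_nth (w : 'I_(size p)) : nth 0 x (nth 0 idx w) = nth 0 s w.
  by rewrite sE (nth_map 0) ?szi.
rewrite !s_nth.
by have [-> ->] := sP u v (ltn_ord u) (ltn_ord v); rewrite !eqxx.
Qed.

(** Occurrences of 12 and 21 are two-letter subsequences, so this turns the push tests of both
    stacks into sortedness. *)
Lemma sorted_subseq2 (e : rel nat) (x : seq nat) : transitive e ->
  sorted e x <-> forall a b, subseq [:: a; b] x -> e a b.
Proof.
move=> e_tr; split=> [x_e a b /(subseq_sorted e_tr)/(_ x_e)|x_e].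
  by rewrite /= andbT.
elim: x x_e => //= a x IHx x_e; rewrite path_sortedE //.
apply/andP; split.
  by apply/allP => b b_x; apply: x_e; rewrite eqxx sub1seq.
apply: IHx => b c sub; apply: x_e.
by case: eqP => // _; rewrite (subseq_trans _ sub) ?subseq_cons.
Qed.

Lemma avoids12 (x : seq nat) : avoids x [:: 1; 2] = sorted geq x.
Proof.
have geq_tr : transitive geq by move=> a b c /= ? ?; lia.
apply/negP/idP => [av|/(sorted_subseq2 _ geq_tr) x_geq].
  apply/(sorted_subseq2 _ geq_tr) => a b sub /=; rewrite leqNgt.
  apply/negP => ltab; apply: av; apply/containsP; exists [:: a; b].
  by split=> // -[|[|u]] [|[|v]] //= _ _; split; lia.
move=> /containsP[s [sub szs sP]].
case: s szs sub sP => [|a [|b [|? ?]]] // _ sub sP.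
have := x_geq _ _ sub; have [] := sP 0 1 isT isT; rewrite /=; lia.
Qed.

Lemma avoids21 (x : seq nat) : avoids x [:: 2; 1] = sorted leq x.
Proof.
apply/negP/idP => [av|/(sorted_subseq2 _ leq_trans) x_leq].
  apply/(sorted_subseq2 _ leq_trans) => a b sub /=; rewrite leqNgt.
  apply/negP => ltab; apply: av; apply/containsP; exists [:: a; b].
  by split=> // -[|[|u]] [|[|v]] //= _ _; split; lia.
move=> /containsP[s [sub szs sP]].
case: s szs sub sP => [|a [|b [|? ?]]] // _ sub sP.
have := x_leq _ _ sub; have [] := sP 0 1 isT isT; rewrite /=; lia.
Qed.

(** The comparisons [a < b] and [b < c] fix the relative order of all three letters. *)
Lemma contains213P (x : seq nat) :
  reflect (exists b a c : nat, [/\ subseq [:: b; a; c] x, a < b & b < c])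
          (contains x [:: 2; 1; 3]).
Proof.
apply: (iffP (containsP _ _)) => [|[b [a [c [sub ltab ltbc]]]]].
  move=> [s [sub szs sP]].
  case: s szs sub sP => [|b [|a [|c [|? ?]]]] // _ sub sP; exists b, a, c.
  have [] := sP 1 0 isT isT; have [] := sP 0 2 isT isT.
  by rewrite /= => -> _ -> _.
exists [:: b; a; c]; split=> //.
by move=> [|[|[|u]]] [|[|[|v]]] //= _ _; split; lia.
Qed.

(** * Runs of a stack, step by step *)

(** The letters already output never influence a push or a pop, so runs can be studied from an empty
    output. *)
Lemma stack_run_out (tau inp st out : seq nat) :
  stack_run tau inp st out = out ++ stack_run tau inp st [::].
Proof.
elim: inp st out => //= a inp IHinp; elim=> [|b st IHst] out /=.
  exact: IHinp.
case: ifP => _; first exact: IHinp.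
by rewrite IHst (IHst [:: b]) -cats1 -catA.
Qed.

(* One step is a single push or a single pop; [out] is the part of the output
   produced from the current state on. *)
Lemma stack_run_ind (tau : seq nat) (e : rel nat)
    (P : seq nat -> seq nat -> seq nat -> Prop) :
  (forall x, avoids x tau = sorted e x) ->
  (forall st, P [::] st st) ->
  (forall a inp, let out := stack_run tau inp [:: a] [::] in
     P inp [:: a] out -> P (a :: inp) [::] out) ->
  (forall a inp b st, let out := stack_run tau inp [:: a, b & st] [::] in
     sorted e [:: a, b & st] -> P inp [:: a, b & st] out ->
     P (a :: inp) (b :: st) out) ->
  (forall a inp b st, let out := stack_run tau (a :: inp) st [::] in
     sorted e (b :: st) -> ~~ e a b -> P (a :: inp) st out ->
     P (a :: inp) (b :: st) (b :: out)) ->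
  forall inp st, sorted e st -> P inp st (stack_run tau inp st [::]).
Proof.
move=> avE Pend Pnil Ppush Ppop; elim=> [|a inp IHinp] st; first by rewrite /=.
elim: st => [_|b st IHst st_e]; first exact/Pnil/IHinp.
rewrite /= avE; case: ifP => [ab_e|]; first by apply: Ppush => //; apply: IHinp.
rewrite /= (st_e : path e b st) andbT => /negbT ne_ab.
rewrite -/(stack_run tau (a :: inp) st [:: b]) stack_run_out.
by apply: Ppop => //; apply/IHst/path_sorted/st_e.
Qed.

Lemma perm_stack_run (tau : seq nat) (e : rel nat) (inp st : seq nat) :
  (forall x, avoids x tau = sorted e x) -> sorted e st ->
  perm_eq (stack_run tau inp st [::]) (st ++ inp).
Proof.
move=> avE; move: inp st.
apply: (stack_run_ind (P := fun inp st out => perm_eq out (st ++ inp)) avE).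
- by move=> st; rewrite cats0.
- by [].
- move=> a inp b st out _ /permPl->.
  by rewrite -cat_rcons perm_cat2r perm_sym perm_rcons.
- by move=> a inp b st out _ _; rewrite perm_cons.
Qed.

(** New letters go on top and pops come from the top, so the letters of a stack leave it in their
    order from top to bottom. *)
Lemma subseq_stack_run (tau : seq nat) (e : rel nat) (inp st : seq nat) :
  (forall x, avoids x tau = sorted e x) -> sorted e st ->
  subseq st (stack_run tau inp st [::]).
Proof.
move=> avE; move: inp st.
apply: (stack_run_ind (P := fun _ st out => subseq st out) avE).
- exact: subseq_refl.
- by move=> *; apply: sub0seq.
- by move=> a inp b st out _; apply: subseq_trans; apply: subseq_cons.
- by move=> a inp b st out _ _ sub; rewrite /= eqxx.
Qed.

Lemma geq_path_all (b : nat) (st : seq nat) :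
  path geq b st -> {in st, forall x, x <= b}.
Proof.
rewrite path_sortedE; last by move=> ? ? ? /= ? ?; lia.
by move=> /andP[/allP].
Qed.

Lemma leq_path_all (b : nat) (st : seq nat) :
  path leq b st -> {in st, forall x, b <= x}.
Proof. by rewrite (path_sortedE leq_trans) => /andP[/allP]. Qed.

(** * The 12-stack *)

(** The word [rev st ++ inp] lists the letters not yet output in their original order, so a pop only
    deletes a letter from it and avoidance of 213 persists. *)
Lemma sorted_stack_map12 (pi : seq nat) :
  avoids pi [:: 2; 1; 3] -> sorted geq (stack_map [:: 1; 2] pi).
Proof.
move=> /contains213P av.
pose P (inp st out : seq nat) := sorted geq st ->
  (forall b a c : nat, subseq [:: b; a; c] (rev st ++ inp) -> a < b -> c <= b) ->
  sorted geq out.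
suff: P pi [::] (stack_map [:: 1; 2] pi).
  apply=> // b a c sub ltab.
  by rewrite leqNgt; apply/negP => ltbc; apply: av; exists b, a, c.
apply: (stack_run_ind (P := P) avoids12) => //.
- by move=> st st_geq.
- move=> a inp b st out st_geq IH _ av'.
  by apply: IH => //; rewrite rev_cons cat_rcons.
- move=> a inp b st out st_geq ne_ab IH _ av'.
  have ltab : a < b by rewrite /= -ltnNge in ne_ab.
  have st_geq' : sorted geq st by apply: path_sorted st_geq.
  rewrite /= path_sortedE; last by move=> ? ? ? /= ? ?; lia.
  apply/andP; split; last first.
    apply: IH => // x y z sub.
    apply: av'; apply: subseq_trans sub _; rewrite rev_cons cat_rcons.
    by rewrite cat_subseq // subseq_cons.
  (* What leaves after [b] lies below it in the sorted stack, is [a], or comes later in the input;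
     only the last case uses avoidance of 213. *)
  apply/allP => c.
  rewrite (perm_mem (perm_stack_run _ avoids12 st_geq')) mem_cat inE /=.
  case/or3P => [/(geq_path_all st_geq)//|/eqP->|c_inp]; first exact: ltnW.
  apply: (av' b a c) => //; rewrite rev_cons cat_rcons -[X in subseq X]cat0s.
  by rewrite cat_subseq ?sub0seq //= !eqxx sub1seq.
Qed.

(** A letter below [b] is popped only by a still smaller one, which is not [c] and replaces it as
    witness. So [c] is pushed above some such letter and leaves first. *)
Lemma stack_run12_contains21 (b c : nat) (u v st : seq nat) :
  b < c -> sorted geq st -> has (gtn b) (st ++ u) ->
  exists2 a, a < b &
    subseq [:: c; a] (stack_run [:: 1; 2] (u ++ c :: v) st [::]).
Proof.
move=> ltbc st_geq.
pose P (inp st out : seq nat) := forall u, inp = u ++ c :: v -> has (gtn b) (st ++ u) ->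
  exists2 a, a < b & subseq [:: c; a] out.
suff: P (u ++ c :: v) st (stack_run [:: 1; 2] (u ++ c :: v) st [::]) by exact.
apply: (stack_run_ind (P := P) avoids12) => //.
- by move=> ? [].
- by move=> x inp out IH [|y u'] //= [<- inpE]; apply: IH.
- move=> x inp t st' out st_e IH [|y u'] /= [<- inpE]; last first.
    move=> has_b; apply: (IH u' inpE); move: has_b.
    by rewrite /= !has_cat /= => /or3P[->|->|/orP[->|->]]; rewrite ?orbT.
  rewrite cats0 => /(@hasP _ _ (t :: st'))[a].
  rewrite -sub1seq => a_st ltab.
  exists a => //; apply: subseq_trans (subseq_stack_run inp avoids12 st_e).
  by rewrite /= eqxx; exact: a_st.
- move=> x inp t st' out st_e; rewrite /= -ltnNge => lt_xt IH u' inpE has_b.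
  have [|a ltab sub] := IH u' inpE.
    case/orP: has_b => //= lttb; case: u' inpE => [[xc _]|y u' [<- _]].
      lia.
    by rewrite has_cat /= (ltn_trans lt_xt lttb) orbT.
  by exists a => //; rewrite (subseq_trans sub) // subseq_cons.
Qed.

Lemma stack_map12_contains231 (pi : seq nat) : contains pi [:: 2; 1; 3] ->
  exists b c a,
    [/\ subseq [:: b; c; a] (stack_map [:: 1; 2] pi), a < b & b < c].
Proof.
move=> /contains213P[b [a0 [c [sub213 lta0b ltbc]]]]; exists b, c.
have [u [v [piE sub_u]]] := @subseq_cat_split _ [:: b; a0] [:: c] _ sub213.
rewrite sub1seq => /splitPr c_v; case: c_v piE => v1 v2; rewrite catA => piE.
(* Holds until a copy of [b] is popped with a smaller letter in the stack or due before [c]. Both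
   alternatives fail for empty [u], so that pop precedes the arrival of [c]. *)
pose P (inp st out : seq nat) := forall u, inp = u ++ c :: v2 ->
  (b \in st) && has (gtn b) u \/ subseq [:: b; a0] u ->
  exists a, [/\ subseq [:: b; c; a] out, a < b & b < c].
have has_b (w : seq nat) : a0 \in w -> has (gtn b) w.
  by move=> a0_w; apply/hasP; exists a0.
suff H : P pi [::] (stack_map [:: 1; 2] pi).
  by apply: H piE _; right; apply: subseq_trans sub_u (prefix_subseq _ _).
apply: (stack_run_ind (P := P) avoids12) => //.
- by move=> ? [].
- move=> x inp out IH [|y u'] /= [<- inpE] [] // sub; apply: (IH u' inpE).
  move: sub; case: eqP => [bx|_]; last by right.
  by rewrite sub1seq => /has_b->; left; rewrite bx mem_head.
- move=> x inp t st out st_e IH [|y u'] /= [<- inpE].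
    by rewrite andbF; case.
  move=> H; apply: (IH u' inpE).
  case: H => [/andP[b_st /orP[ltxb|has_u]]|].
  (* The 12-stack never takes a letter smaller than [b] while holding [b]. *)
  + have lebx := geq_path_all st_e b_st; rewrite /= in ltxb; lia.
  + by left; rewrite inE b_st orbT.
  + case: eqP => [bx|_]; last by right.
    by rewrite sub1seq => /has_b->; left; rewrite bx mem_head.
- move=> x inp t st out st_e ne_xt IH u' inpE H.
  have st_e' : sorted geq st by apply: path_sorted st_e.
  (* If the popped [t] equals [b], it starts the 231. The final letter [a] need not be [a0], which
     may itself leave before [c]. *)
  have [/andP[/eqP tb has_u]|H'] : (b == t) && has (gtn b) u' \/
      ((b \in st) && has (gtn b) u' \/ subseq [:: b; a0] u').
    case: H => [|?]; last by right; right.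
    by rewrite inE => /andP[/orP[]-> ->]; [left | right; left].
    have [a ltab sub] : exists2 a, a < b & subseq [:: c; a] out.
      rewrite /out inpE; apply: stack_run12_contains21 => //.
      by rewrite has_cat has_u orbT.
    by exists a; split=> //; rewrite tb /= eqxx.
  have [a [sub ltab _]] := IH u' inpE H'.
  by exists a; split=> //; apply: subseq_trans sub (subseq_cons _ _).
Qed.

(** * The 21-stack and the conclusion *)

(** Under this hypothesis every push is allowed, so nothing is popped before the input ends. *)
Lemma stack_run21_rev (inp st out : seq nat) :
  sorted leq (rev inp ++ st) ->
  stack_run [:: 2; 1] inp st out = out ++ rev inp ++ st.
Proof.
elim: inp st out => //= a inp IHinp st out; rewrite rev_cons cat_rcons.
move=> inp_leq; have : sorted leq (a :: st).
  by move: inp_leq; rewrite sorted_cat_cons => /andP[].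
by case: st inp_leq => [|b st] inp_leq; rewrite /= ?avoids21 => st_leq;
  rewrite /= ?st_leq IHinp.
Qed.

Lemma stack_map21_contains21 (w : seq nat) (b c a : nat) :
  subseq [:: b; c; a] w -> a < b -> b < c ->
  subseq [:: b; a] (stack_map [:: 2; 1] w).
Proof.
move=> sub231 ltab ltbc.
have [u [v [wE]]] := @subseq_cat_split _ [:: b] [:: c; a] _ sub231.
rewrite sub1seq => b_u.
case/(@subseq_cat_split _ [:: c] [:: a]) => [v1 [v2 [vE]]].
rewrite !sub1seq => /splitPr c_v1 a_v2.
case: c_v1 vE => v0 v1' vE.
have {}wE : w = (u ++ v0) ++ c :: (v1' ++ v2) by rewrite wE vE -!catA.
pose P (inp st out : seq nat) := forall u, inp = u ++ c :: (v1' ++ v2) ->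
  b \in st ++ u -> subseq [:: b; a] out.
suff H : P w [::] (stack_map [:: 2; 1] w).
  by apply: H wE _; rewrite /= mem_cat b_u.
apply: (stack_run_ind (P := P) avoids21) => //.
- by move=> ? [].
- by move=> x inp out IH [|y u'] //= [<- inpE]; apply: IH.
- move=> x inp t st out st_leq IH [|y u'] [xE inpE].
    (* Here [c] would be pushed above [b], against [b < c]. *)
    rewrite cats0 => b_st; have := leq_path_all st_leq b_st; lia.
  move=> b_in; apply: (IH u' inpE); move: b_in.
  by rewrite xE !(inE, mem_cat) => /or3P[->|->|/orP[->|->]]; rewrite ?orbT.
- move=> x inp t st out st_leq _ IH u' inpE.
  have st_leq' : sorted leq st by apply: path_sorted st_leq.
  rewrite cat_cons inE => /orP[/eqP->|b_in]; last first.
    by apply: subseq_trans (IH u' inpE b_in) (subseq_cons _ _).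
  (* When [b] is popped, [c] has not been pushed, so [a] is still in the input and must leave
     later. *)
  rewrite /= eqxx sub1seq (perm_mem (perm_stack_run _ avoids21 st_leq')).
  by rewrite inpE !(mem_cat, inE) a_v2 !orbT.
Qed.

Theorem theorem3 : Sort [:: 1; 2] =i CayleyAv [:: 2; 1; 3].
Proof.
move=> pi; rewrite !inE; congr (_ && _); apply/idP/idP => [out_leq|av].
  apply/negP => /stack_map12_contains231[b [c [a [sub ltab ltbc]]]].
  have sub21 := stack_map21_contains21 sub ltab ltbc.
  have := (sorted_subseq2 _ leq_trans).1 out_leq _ _ sub21; lia.
have w_leq : sorted leq (rev (stack_map [:: 1; 2] pi) ++ [::]).
  by rewrite cats0 rev_sorted; apply: sorted_stack_map12.
by rewrite /machine [stack_map [:: 2; 1] _]stack_run21_rev.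
Qed.
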